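(* For any consecutive pattern $\sigma$, the vincular patterns $1\oplus\sigma$ and $1\ominus\sigma$ are filling-shape-Wilf-equivalent.
   Context: A vincular pattern of length $k$ is a pair $(\sigma,X)$ with $\sigma\in S_k$ and $X\subseteq[k-1]$. It is consecutive if $X=[k-1]$, and it is written with a dash between positions $j,j+1$ exactly when $j\notin X$. For $(\alpha,A)$ of length $k$ and $(\tau,B)$ of length $\ell$: - direct sum: $(\alpha,A)\oplus(\tau,B)=(\alpha_1\cdots\alpha_k(\tau_1+k)\cdots(\tau_\ell+k),\ A\cup\{i+k:i\in B\})$; - skew sum: $(\alpha,A)\ominus(\tau,B)=((\alpha_1+\ell)\cdots(\alpha_k+\ell)\tau_1\cdots\tau_\ell,\ A\cup\{i+k:i\in B\})$. Here $1$ denotes the pattern $(1,\emptyset)$. For example, $1\oplus 12=1\text{-}23$ and $1\ominus12=3\text{-}12$. A Young board $\lambda=(\lambda_1,\dots,\lambda_n)$ with $\lambda_1\ge\dots\ge\lambda_n>0$ is the cell set $\{(i,j):1\le i\le n,\ 1\le j\le\lambda_i\}$, with width $n$ and height $\lambda_1$. A filling is a $0/1$ assignment to the cells with at most one $1$ per row and per column. It is encoded by the word $\pi_1\cdots\pi_n$ with $\pi_c=r$ if $(c,r)$ holds a $1$ and $\pi_c=\square$ if column $c$ is empty. A filling $\pi$ contains $(\sigma,X)$ if there are $i_1<\dots<i_k$ such that all of the following hold: - all $\pi_{i_j}$ are numbers; - $\pi_{i_1}\cdots\pi_{i_k}$ is order-isomorphic to $\sigma$; - $i_{j+1}=i_j+1$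 for $j\in X$; - the cell $(i_k,\max_j\pi_{i_j})$ lies in $\lambda$. Otherwise $\pi$ avoids $(\sigma,X)$. $\mathcal{S}_\lambda^{C,R}(\sigma)$ denotes the set of fillings of $\lambda$ with empty columns exactly $C$ and empty rows exactly $R$ that avoid $\sigma$. Patterns $\sigma,\tau$ are filling-shape-Wilf-equivalent if $|\mathcal{S}_\lambda^{C,R}(\sigma)|=|\mathcal{S}_\lambda^{C,R}(\tau)|$ for all Young boards $\lambda$ and all $C\subseteq[\text{width}]$, $R\subseteq[\text{height}]$. *)

(* Defs.v *)
From mathcomp Require Import all_boot all_fingroup.

Set Implicit Arguments.
Unset Strict Implicit.
Unset Printing Implicit Defensive.

(* Positions, values, columns and rows are all numbered from 0. An adjacency
   j : 'I_k.-1 in vadj forces the entries in positions j and j.+1 to be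
   adjacent (it is the element j.+1 of X in the 1-based notation). *)
Record vpattern (k : nat) := VPattern {
  vperm : 'S_k;
  vadj : {set 'I_k.-1}
}.

Definition consecutive (k : nat) (p : vpattern k) : Prop := vadj p = [set: 'I_k.-1].

Definition vone : vpattern 1 := VPattern 1%g set0.

Definition dsum_fun (k l : nat) (s : 'S_k) (t : 'S_l) (x : 'I_(k + l)) :
    'I_(k + l) :=
  match split x with
  | inl a => lshift l (s a)
  | inr b => rshift k (t b)
  end.

Lemma dsum_fun_inj (k l : nat) (s : 'S_k) (t : 'S_l) : injective (dsum_fun s t).
Proof.
move=> x y; rewrite /dsum_fun -{2}(splitK x) -{2}(splitK y).
case: (split x) => a; case: (split y) => b /=.
- by move/lshift_inj/perm_inj->.
- by move/eqP; rewrite eq_lrshift.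
- by move/eqP; rewrite eq_rlshift.
- by move/rshift_inj/perm_inj->.
Qed.

Definition skewsum_fun (k l : nat) (s : 'S_k) (t : 'S_l) (x : 'I_(k + l)) :
    'I_(k + l) :=
  cast_ord (addnC l k)
    match split x with
    | inl a => rshift l (s a)
    | inr b => lshift k (t b)
    end.

Lemma skewsum_fun_inj (k l : nat) (s : 'S_k) (t : 'S_l) :
  injective (skewsum_fun s t).
Proof.
move=> x y /cast_ord_inj; rewrite -{2}(splitK x) -{2}(splitK y).
case: (split x) => a; case: (split y) => b /=.
- by move/rshift_inj/perm_inj->.
- by move/eqP; rewrite eq_rlshift.
- by move/eqP; rewrite eq_lrshift.
- by move/lshift_inj/perm_inj->.
Qed.

Definition sum_adj (k l : nat) (A : {set 'I_k.-1}) (B : {set 'I_l.-1}) :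
    {set 'I_(k + l).-1} :=
  [set x : 'I_(k + l).-1 | [exists a in A, val x == val a]
                        || [exists b in B, val x == val b + k]].

Definition dsum (k l : nat) (p : vpattern k) (q : vpattern l) :
    vpattern (k + l) :=
  VPattern (perm (dsum_fun_inj (s := vperm p) (t := vperm q)))
           (sum_adj (vadj p) (vadj q)).

Definition skewsum (k l : nat) (p : vpattern k) (q : vpattern l) :
    vpattern (k + l) :=
  VPattern (perm (skewsum_fun_inj (s := vperm p) (t := vperm q)))
           (sum_adj (vadj p) (vadj q)).

(* A board is the sequence of its column heights, listed left to right. *)
Definition young_board (lam : seq nat) : bool :=
  sorted geq lam && all (fun m => 0 < m) lam.

Definition width (lam : seq nat) : nat := size lam.

Definition height (lam : seq nat) : nat := head 0 lam.

Definition in_board (lam : seq nat) (c r : nat) : bool :=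
  (c < width lam) && (r < nth 0 lam c).

(* A 0/1 assignment is represented by the set of (column, row) cells that
   hold a 1. *)
Definition is_filling (lam : seq nat)
    (F : {set 'I_(width lam) * 'I_(height lam)}) : bool :=
  [&& [forall x in F, in_board lam x.1 x.2],
      [forall x in F, forall y in F, (x.1 == y.1) ==> (x == y)] &
      [forall x in F, forall y in F, (x.2 == y.2) ==> (x == y)]].

Definition word (lam : seq nat) (F : {set 'I_(width lam) * 'I_(height lam)})
    (c : 'I_(width lam)) : option 'I_(height lam) :=
  [pick r | (c, r) \in F].

(* The last clause is about the final position of the pattern, the a with
   a.+1 = k. *)
Definition contains (lam : seq nat)
    (F : {set 'I_(width lam) * 'I_(height lam)}) (k : nat) (p : vpattern k) :
    bool :=
  [exists i : {ffun 'I_k -> 'I_(width lam)},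
   exists v : {ffun 'I_k -> 'I_(height lam)},
   [&& [forall a : 'I_k, forall b : 'I_k, (a < b) ==> (i a < i b)],
       [forall a : 'I_k, word F (i a) == Some (v a)],
       [forall a : 'I_k, forall b : 'I_k,
          (v a < v b) == (vperm p a < vperm p b)],
       [forall j in vadj p, forall a : 'I_k, forall b : 'I_k,
          (val a == val j) && (val b == j.+1) ==> (val (i b) == (i a).+1)] &
       [forall a : 'I_k,
          (a.+1 == k) ==> in_board lam (i a) (\max_(b < k) v b)]]].

Definition empty_columns (lam : seq nat)
    (F : {set 'I_(width lam) * 'I_(height lam)}) : {set 'I_(width lam)} :=
  [set c | [forall r, (c, r) \notin F]].

Definition empty_rows (lam : seq nat)
    (F : {set 'I_(width lam) * 'I_(height lam)}) : {set 'I_(height lam)} :=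
  [set r | [forall c, (c, r) \notin F]].

Definition avoiders (lam : seq nat) (C : {set 'I_(width lam)})
    (R : {set 'I_(height lam)}) (k : nat) (p : vpattern k) :
    {set {set 'I_(width lam) * 'I_(height lam)}} :=
  [set F | [&& is_filling F, empty_columns F == C, empty_rows F == R &
               ~~ contains F p]].

Definition filling_shape_Wilf_equivalent (k l : nat) (p : vpattern k)
    (q : vpattern l) : Prop :=
  forall lam : seq nat, young_board lam ->
  forall (C : {set 'I_(width lam)}) (R : {set 'I_(height lam)}),
    #|avoiders C R p| = #|avoiders C R q|.

(* Main.v *)
(** Read a filling from right to left, and let A_c be the set of the rows below
    the height of column c that carry a 1 in some column up to c.  A window
    that ends in column e is the end of an occurrence of 1 (+) sigma exactly
    when it is order-isomorphic to sigma, lies in A_e and misses the minimum of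
    A_e: that minimum then sits to the left of the window and can play the 1.
    For 1 (-) sigma the same holds with the maximum of A_e.  The sizes of the
    A_c depend only on the board and on the empty rows and columns, so the
    fillings are encoded by the ranks of the entries pi_c in the A_c, and
    lowering every rank by 1 modulo the size of A_c permutes the fillings.  The
    increasing bijection between A_e minus its minimum and the new A_e minus
    its maximum matches the windows of the two kinds, because the rows that
    become available when the board gets higher lie above all the others. *)

Require Import Defs.
From mathcomp Require Import all_boot all_fingroup.
From mathcomp Require Import zify.

Set Implicit Arguments.
Unset Strict Implicit.
Unset Printing Implicit Defensive.

(** * Words read from the right, available rows, and the lowering of ranks *)

(* The word s lists the columns to the right of the current one, whose height
   is therefore h (size s); the rows satisfying B are those that must stay
   empty. *)
Definition avail (h : nat -> nat) (B : pred nat) (s : seq (option nat)) :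
    seq nat :=
  [seq r <- iota 0 (h (size s)) | ~~ B r & Some r \notin s].

Fixpoint legal (h : nat -> nat) (B : pred nat) (s : seq (option nat)) : bool :=
  if s is o :: s' then
    (if o is Some x then x \in avail h B s' else true) && legal h B s'
  else true.

(** Lowers the rank by one cyclically, rank 0 going to the top of [A']. When [A] and [A'] have equal
    size and [x] is in [A], the default 0 of [nth] is never reached. *)
Definition rotate (A A' : seq nat) (x : nat) : nat :=
  nth 0 A' (if index x A is i.+1 then i else (size A').-1).

(** The tail is transformed first, because the rows open to the new entry depend on the new entries
    to its right. *)
Fixpoint shift (h : nat -> nat) (B : pred nat) (s : seq (option nat)) :
    seq (option nat) :=
  if s is o :: s' then
    omap (rotate (avail h B s') (avail h B (shift h B s'))) o :: shift h B s'
  else [::].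

Lemma mem_avail h B s r :
  (r \in avail h B s) = [&& ~~ B r, Some r \notin s & r < h (size s)].
Proof. by rewrite mem_filter mem_iota add0n /= andbA. Qed.

Lemma sorted_avail h B s : sorted ltn (avail h B s).
Proof. exact: (sorted_filter ltn_trans) (iota_ltn_sorted _ _). Qed.

Lemma uniq_avail h B s : uniq (avail h B s).
Proof. exact: filter_uniq (iota_uniq _ _). Qed.

Lemma size_shift h B s : size (shift h B s) = size s.
Proof. by elim: s => //= o s ->. Qed.

Lemma shift_cat h B t s :
  exists2 t', shift h B (t ++ s) = t' ++ shift h B s & size t' = size t.
Proof.
elim: t => [|o t [t' eq_t' size_t']] /=; first by exists [::].
by rewrite eq_t'; eexists (_ :: t'); rewrite //= size_t'.
Qed.

Lemma legal_cat h B t s : legal h B (t ++ s) -> legal h B s.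
Proof. by elim: t => //= o t IH /andP[_ /IH]. Qed.

Lemma legal_bound h B s x :
  {homo h : i j / i <= j} -> legal h B s -> Some x \in s -> x < h (size s).
Proof.
move=> h_mono; elim: s => //= o s IH /andP[o_ok s_ok].
rewrite inE => /orP[/eqP eq_o|/(IH s_ok) lt_x].
  move: o_ok; rewrite -eq_o mem_avail => /and3P[_ _ lt_x].
  exact: leq_trans lt_x (h_mono _ _ (leqnSn _)).
exact: leq_trans lt_x (h_mono _ _ (leqnSn _)).
Qed.

(** The rows gained by moving one column to the left lie above every height met so far, so no entry
    of [o :: s] can occupy them. They come after all the old rows, whose ranks they leave
    unchanged. *)
Lemma avail_cons h B o s :
  {homo h : i j / i <= j} -> legal h B (o :: s) ->
  avail h B (o :: s) =
    [seq r <- avail h B s | Some r != o] ++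
    [seq r <- iota (h (size s)) (h (size s).+1 - h (size s)) | ~~ B r].
Proof.
move=> h_mono os_ok; have [o_ok s_ok] := andP os_ok.
rewrite {1}/avail /= -{1}(subnKC (h_mono _ _ (leqnSn (size s)))) iotaD filter_cat -filter_predI.
congr (_ ++ _); apply: eq_in_filter => r.
  by move=> _ /=; rewrite inE negb_or andbCA.
rewrite mem_iota => /andP[ge_r _]; rewrite inE negb_or.
suff [-> ->] : Some r != o /\ Some r \notin s by rewrite !andbT.
split; last by apply/negP=> /(legal_bound h_mono s_ok); rewrite ltnNge ge_r.
apply: contraTneq o_ok => <-; rewrite mem_avail => /=; apply/negP=> /and3P[_ _].
by rewrite ltnNge ge_r.
Qed.

Lemma size_filter_neq (A : seq nat) x :
  uniq A -> x \in A -> size [seq r <- A | Some r != Some x] = (size A).-1.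
Proof.
move=> uA xA; rewrite -(size_rem xA) (rem_filter _ uA).
by congr size; apply: eq_filter => r; rewrite /= (inj_eq Some_inj).
Qed.

Lemma cyclic_pred_lt n i : i < n -> (if i is j.+1 then j else n.-1) < n.
Proof. by case: i => [|i] lt_in; lia. Qed.

Lemma cyclic_pred_inj n i j :
  i < n -> j < n ->
  (if i is i'.+1 then i' else n.-1) = (if j is j'.+1 then j' else n.-1) ->
  i = j.
Proof. by case: i => [|i]; case: j => [|j] //= *; lia. Qed.

Lemma rotate_mem (A A' : seq nat) x :
  size A' = size A -> x \in A -> rotate A A' x \in A'.
Proof.
by move=> szA; rewrite -index_mem -szA => lt_x; apply/mem_nth/cyclic_pred_lt.
Qed.

Lemma rotate_inj (A A' : seq nat) :
  size A' = size A -> uniq A' -> {in A &, injective (rotate A A')}.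
Proof.
move=> szA uA' x y xA yA; have := xA; have := yA.
rewrite -!index_mem -szA => lt_y lt_x /eqP.
rewrite nth_uniq ?cyclic_pred_lt // => /eqP/(cyclic_pred_inj lt_x lt_y) eq_i.
by rewrite -(nth_index 0 xA) eq_i nth_index.
Qed.

(** Both words consume a row in the same columns and gain the same new rows, so the counts stay
    equal; equal counts in turn make [rotate] land among the available rows. *)
Lemma legal_shift h B s :
  {homo h : i j / i <= j} -> legal h B s ->
  legal h B (shift h B s) /\
  size (avail h B (shift h B s)) = size (avail h B s).
Proof.
move=> h_mono; elim: s => // o s IH os_ok.
have /= /andP[o_ok s_ok] := os_ok; have [s'_ok szA] := IH s_ok.
have os'_ok : legal h B (shift h B (o :: s)).
  by case: o {os_ok} o_ok => //= x x_in; rewrite rotate_mem.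
split=> //; rewrite [shift _ _ _]/= !avail_cons // !size_cat size_shift.
congr (_ + _); case: o o_ok {os_ok os'_ok} => [x x_in|_] /=; last first.
  by rewrite !filter_predT.
by rewrite !size_filter_neq ?uniq_avail ?rotate_mem ?szA.
Qed.

(** Decoding runs from the right: once the tails agree, the available rows agree too, and
    [rotate_inj] recovers the next entry. *)
Lemma shift_inj h B s1 s2 :
  {homo h : i j / i <= j} -> legal h B s1 -> legal h B s2 ->
  shift h B s1 = shift h B s2 -> s1 = s2.
Proof.
move=> h_mono; elim: s1 s2 => [|o1 s1 IH] [|o2 s2] //= /andP[o1_ok s1_ok].
case/andP=> o2_ok s2_ok [eq_o eq_s]; move: o2_ok eq_o.
rewrite -(IH _ s1_ok s2_ok eq_s) => {s2 s2_ok eq_s}.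
case: o1 o1_ok => [x1|] o1_ok; case: o2 => [x2|] //= o2_ok [].
by move/rotate_inj=> -> //; rewrite ?uniq_avail // (legal_shift h_mono s1_ok).2.
Qed.

(** * Windows under the shift *)

(* While a window stays inside S, the rows of S that are left and those of the
   image of S that are left correspond under g: the rows that become available
   meanwhile come after them. *)
Lemma shift_window h B (g : nat -> nat) s m S M0 t :
  {homo h : i j / i <= j} -> {in S &, injective g} -> size M0 = 1 ->
  avail h B s = m :: S -> avail h B (shift h B s) = map g S ++ M0 ->
  legal h B (t ++ s) ->
  exists t', [/\ shift h B (t ++ s) = t' ++ shift h B s,
    all (fun o => o \in map Some S) t = all (fun o =>
      o \in map Some (map g S)) t' &
    all (fun o => o \in map Some S) t ->
      t' = map (omap g) t /\
      exists M M', [/\ avail h B (t ++ s) = m :: [seq r <- S | Some r \notin t] ++ M,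
        avail h B (shift h B (t ++ s)) =
          [seq g r | r <- S & Some r \notin t] ++ M' &
        size M' = (size M).+1]].
Proof.
move=> h_mono g_inj szM0 eqA eqA'; elim: t => [|o t IH] t_ok.
  (* For the empty window [M] is empty and [M'] is [M0], whose single row balances [m]. *)
  by exists [::]; split=> //; split=> //; exists [::], M0;
    rewrite filter_predT cats0.
have /= /andP[o_ok ts_ok] := t_ok; have [t' [eq_t' eq_all IHt]] := IH ts_ok.
rewrite [shift _ _ _]/= eq_t'.
set A := avail h B (t ++ s) in o_ok IHt *.
have szA : size (avail h B (shift h B (t ++ s))) = size A.
  by have [] := legal_shift h_mono ts_ok.
have uA' := uniq_avail h B (shift h B (t ++ s)).
have uA : uniq A := uniq_avail h B (t ++ s).
rewrite -eq_t'; set A' := avail h B (shift h B (t ++ s)) in szA IHt uA' *.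
exists (omap (rotate A A') o :: t'); rewrite eq_t' /= -eq_all.
(* Once [t] has left [S], both sides of the equality are false and nothing more is claimed. *)
case t_in: (all _ t) IHt; last by rewrite !andbF => _; split.
rewrite !andbT => /(_ isT) [eq_map [M [M' [eqAt eqAt' szM]]]].
set T := [seq r <- S | Some r \notin t] in eqAt eqAt'.
have uS : uniq S by have := uniq_avail h B s; rewrite eqA => /andP[].
case: o o_ok t_ok => [x|] /= x_in t_ok; last first.
  have none_in L : None \in map (@Some nat) L = false by apply/mapP => -[].
  by rewrite !none_in.
rewrite !(mem_map Some_inj).
(* The leading [m] puts each row of [T] one rank above its image in [A'], so lowering the rank by
   one is exactly [g]. *)
have rotE r : r \in T -> rotate A A' r = g r.
  move=> rT; rewrite /rotate eqAt /=; case: eqP => [eq_m|_].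
    by move: uA; rewrite eqAt /= mem_cat eq_m rT.
  rewrite index_cat rT eqAt' nth_cat size_map index_mem rT.
  by rewrite (nth_map 0) ?index_mem // nth_index.
have mem_T r : r \in A -> (r \in S) = (r \in T).
  by rewrite /A mem_avail mem_filter => /and3P[_ + _];
    rewrite mem_cat negb_or => /andP[-> _].
have TA r : r \in T -> r \in A by move=> rT; rewrite eqAt inE mem_cat rT orbT.
(* From right to left, let the new entry be [g r] with [r] in [S]. If [r] were in [t], then [g r]
   would already be used in [t']; so [r] is still in [T], and injectivity of [rotate] forces
   [x = r]. *)
have eq_in : (x \in S) = (rotate A A' x \in map g S).
  rewrite mem_T //; apply/idP/mapP => [xT|[r rS eq_g]].
    by exists x; [move: xT; rewrite mem_filter => /andP[] | exact: rotE].
  have rT : r \in T.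
    rewrite mem_filter rS andbT; have := rotate_mem szA x_in.
    rewrite eq_g /A' mem_avail eq_t' => /and3P[_ + _]; apply: contra => r_t.
    by rewrite mem_cat eq_map (map_f (omap g) r_t).
  suff -> : x = r by [].
  by apply: (rotate_inj szA uA' x_in (TA _ rT)); rewrite eq_g rotE.
split=> // xS; have xT : x \in T by rewrite -mem_T.
split; first by rewrite eq_map rotE.
have := avail_cons (o := Some x) h_mono t_ok; rewrite -/A => ->.
have [] := legal_shift (s := Some x :: t ++ s) h_mono t_ok.
rewrite [shift _ _ _]/= -/A -/A' rotE // => t'_ok _;
  rewrite -eq_t' (avail_cons h_mono t'_ok) -/A' size_shift.
(* Both words gain the same new rows [N], so the two remainders still differ by one in size. *)
set N := [seq _ <- iota _ _ | _]; exists (M ++ N), (M' ++ N).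
rewrite !size_cat szM; split=> //.
  move: uA; rewrite eqAt /= mem_cat cat_uniq negb_or =>
    /and4P[/andP[mT _] _ TM _].
  have -> : Some m != Some x by apply: contraNneq mT => -[->].
  rewrite filter_cat /= -catA; congr (_ :: _ ++ _).
    rewrite -filter_predI; apply: eq_filter => r /=.
    by rewrite inE negb_or andbC.
  rewrite (all_filterP _) //; apply/allP => r rM; apply: contraTneq rM => -[->].
  by apply: contra TM => xM; apply/hasP; exists x.
move: uA'; rewrite eqAt' cat_uniq => /and3P[_ TM _].
rewrite filter_cat -catA filter_map; congr (map _ _ ++ _).
  rewrite -filter_predI; apply: eq_in_filter => r rS /=.
  rewrite inE negb_or andbC (inj_eq Some_inj) (inj_in_eq g_inj) //.
  by rewrite andbC (inj_eq Some_inj) andbC.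
rewrite (all_filterP _) //; apply/allP => r rM; apply: contraTneq rM => -[->].
by apply: contra TM => xM; apply/hasP; exists (g x); rewrite // map_f.
Qed.

Definition unmax (A : seq nat) : seq nat := take (size A).-1 A.

(** Since [s] begins right after the window, [avail h B s] is the set A_e of the last column e of
    the window. *)
Definition has_free_window (h : nat -> nat) (B : pred nat)
    (free : seq nat -> seq nat) (Q : seq nat -> Prop) (w : seq (option nat)) :
    Prop :=
  exists pre xs s, [/\ w = pre ++ map Some xs ++ s, Q xs &
    {subset xs <= free (avail h B s)}].

Lemma sorted_ltn_nth_mono (s : seq nat) :
  sorted ltn s ->
  {in [pred i | i < size s] &, {mono nth 0 s : i j / i < j}}.
Proof.
move=> s_sorted i j lt_i lt_j.
have lt_nth := sorted_ltn_nth ltn_trans 0 s_sorted.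
have [lt_ij|lt_ji|->] := ltngtP i j; last by rewrite ltnn.
  exact: lt_nth.
by apply/negbTE; rewrite -leqNgt ltnW // lt_nth.
Qed.

Lemma transfer_map (S A : seq nat) :
  uniq S -> size S <= size A ->
  map (fun x => nth 0 A (index x S)) S = take (size S) A.
Proof.
move=> uS leSA; apply: (@eq_from_nth _ 0) => [|i].
  by rewrite size_map size_takel.
by rewrite size_map => lt_i; rewrite (nth_map 0) // index_uniq // nth_take.
Qed.

Lemma transfer_mono (S A : seq nat) :
  sorted ltn S -> sorted ltn A -> size S <= size A ->
  {in S &, {mono (fun x => nth 0 A (index x S)) : x y / x < y}}.
Proof.
move=> sS sA leSA x y xS yS; rewrite sorted_ltn_nth_mono ?inE //;
  try by apply: leq_trans leSA; rewrite index_mem.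
by rewrite -(sorted_ltn_nth_mono sS) ?inE ?index_mem // !nth_index.
Qed.

Lemma free_window_shift h B (Q : seq nat -> Prop) w :
  {homo h : i j / i <= j} -> legal h B w ->
  (forall (g : nat -> nat) xs,
     {in xs &, {mono g : x y / x < y}} -> Q (map g xs) <-> Q xs) ->
  has_free_window h B behead Q w <-> has_free_window h B unmax Q (shift h B w).
Proof.
move=> h_mono w_ok Q_map.
(* Windows at the same position and of the same length are compared, a form that serves both
   directions. *)
suff window pre t s : w = pre ++ t ++ s -> exists pre' t',
    [/\ shift h B w = pre' ++ t' ++ shift h B s, size t' = size t,
        size pre' = size pre &
        (exists2 xs, t = map Some xs &
           Q xs /\ {subset xs <= behead (avail h B s)}) <->
        (exists2 xs, t' = map Some xs &
           Q xs /\ {subset xs <= unmax (avail h B (shift h B s))})].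
  split=> [[pre [xs [s [eq_w Qxs sub_xs]]]]|[pre [ys [s [eq_w Qys sub_ys]]]]].
    have [pre' [t' [-> _ _ [[|ys -> [Qys sub_ys] _]]]]] := window _ _ _ eq_w.
      by exists xs.
    by exists pre', ys, (shift h B s).
  (* For the converse, [w] is cut where the window of the shifted word lies; equal lengths then
     identify the pieces. *)
  pose i := size pre; pose k := size ys.
  have size_w : size w = i + (k + size s).
    by rewrite -(size_shift h B) eq_w !size_cat size_map.
  have le_i : i <= size w by lia.
  have le_k : k <= size (drop i w) by rewrite size_drop; lia.
  have [|pre' [t' [eq_w' size_t' size_pre' [_ []]]]] :=
      window (take i w) (take k (drop i w)) (drop k (drop i w)).
  - by rewrite !cat_take_drop.
  - exists ys; last split=> //.
      move/eqP: eq_w; rewrite eq_w' eqseq_cat ?size_pre' ?size_takel //.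
      rewrite eqseq_cat ?size_t' ?size_takel ?size_map // => /and3P[_ /eqP //].
    move/eqP: eq_w; rewrite eq_w' eqseq_cat ?size_pre' ?size_takel //.
    rewrite eqseq_cat ?size_t' ?size_takel ?size_map // => /and3P[_ _ /eqP->].
    exact: sub_ys.
  move=> xs eq_t [Qxs sub_xs]; exists (take i w), xs, (drop k (drop i w)).
  by rewrite -eq_t !cat_take_drop.
move=> eq_w; have [pre' eq_pre' size_pre'] := shift_cat h B pre (t ++ s).
move: (w_ok); rewrite eq_w => /legal_cat ts_ok.
have [_ szA] := legal_shift h_mono (legal_cat ts_ok).
have uA := uniq_avail h B s.
have sA := sorted_avail h B s; have sA' := sorted_avail h B (shift h B s).
(* If no row is available, neither [behead] nor [unmax] leaves anything, so only an empty window
   qualifies on either side. *)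
case eqA : (avail h B s) szA uA sA => [|m S] szA uA sA.
  have [t' eq_t' size_t'] := shift_cat h B t s; exists pre', t'.
  rewrite eq_pre' eq_t'; split=> //; rewrite (size0nil szA).
  split=> -[[|x xs] eq_xs [Qxs sub_xs]];
    try by have := sub_xs x; rewrite inE eqxx => /(_ isT).
    by exists [::] => //; apply/nilP; rewrite /nilp size_t' eq_xs.
  by exists [::] => //; apply/nilP; rewrite /nilp -size_t' eq_xs.
set A' := avail h B (shift h B s) in szA sA' *.
(* [g] preserves ranks from [S], the available rows without their minimum, to [A'] without its
   maximum. *)
pose g x := nth 0 A' (index x S).
have leSA : size S <= size A' by rewrite szA /=.
have /= /andP[_ uS] := uA; have sS : sorted ltn S := path_sorted sA.
have g_mono : {in S &, {mono g : x y / x < y}} by exact: transfer_mono.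
have g_inj : {in S &, injective g}.
  move=> x y xS yS eq_g; have := g_mono x y xS yS; have := g_mono y x yS xS.
  by rewrite eq_g ltnn; case: ltngtP.
have eq_gS : map g S = unmax A' by rewrite transfer_map // /unmax szA.
have eqA' : A' = map g S ++ drop (size S) A' by rewrite transfer_map // cat_take_drop.
have szM : size (drop (size S) A') = 1 by rewrite size_drop szA /= subSnn.
have [t' [eq_t' eq_all t_all]] :=
  shift_window h_mono g_inj szM eqA eqA' ts_ok.
have all_Some xs (L : seq nat) :
    {subset xs <= L} -> all (fun o => o \in map Some L) (map Some xs).
  by move=> sub_xs; rewrite all_map; apply/allP => x /sub_xs; apply: map_f.
have sub_Some xs (L : seq nat) :
    all (fun o => o \in map Some L) (map Some xs) -> {subset xs <= L}.
  rewrite all_map => /allP all_xs x /all_xs /=.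
  by rewrite (mem_map Some_inj).
exists pre', t'; split; rewrite ?eq_pre' ?eq_t' //.
  move/(congr1 size): eq_t'; rewrite !size_shift !size_cat size_shift; lia.
rewrite -eq_gS; split=> -[].
  move=> xs eq_t [Qxs /all_Some]; rewrite /= -eq_t => t_in.
  have [-> _] := t_all t_in; exists (map g xs);
    first by rewrite eq_t -!map_comp.
  have sub_xs : {subset xs <= S} by apply: sub_Some; rewrite -eq_t.
  split; first by apply/Q_map => // x y /sub_xs xS /sub_xs yS; apply: g_mono.
  by move=> _ /mapP[x /sub_xs xS ->]; apply: map_f.
move=> ys eq_t'_ys [Qys /all_Some]; rewrite -eq_t'_ys -eq_all => t_in.
(* By [eq_all] the window [t] lies in [S] as well, so none of its columns is empty. *)
have [xs eq_t] : exists xs, t = map Some xs.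
  elim: (t) t_in => [|o t1 IH] /=; first by exists [::].
  by case/andP=> /mapP[x _ ->] /IH[xs ->]; exists (x :: xs).
have sub_xs : {subset xs <= S} by apply: sub_Some; rewrite -eq_t.
exists xs => //; split=> //.
have [+ _] := t_all t_in; rewrite eq_t'_ys eq_t -map_comp.
rewrite [in X in _ = X](_ : map _ xs = map Some (map g xs)); last first.
  by rewrite -map_comp.
move/(inj_map Some_inj) => eq_ys.
move: Qys; rewrite eq_ys => /Q_map; apply=> x y /sub_xs xS /sub_xs yS.
exact: g_mono.
Qed.

(** * Occurrences of the patterns as free windows *)

Definition has_pattern (h : nat -> nat) (lt : rel nat) (Q : seq nat -> Prop)
    (w : seq (option nat)) : Prop :=
  exists pre x0 mid xs s,
    [/\ w = pre ++ Some x0 :: mid ++ map Some xs ++ s, Q xs,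
        all (fun x => x < h (size s)) (x0 :: xs) & all (lt x0) xs].

(** In a strictly increasing list an element exceeds another one exactly when it is not the head,
    and the head then lies below all of [xs] at once. *)
Lemma sub_behead (A xs : seq nat) :
  sorted ltn A -> xs != [::] ->
  {subset xs <= behead A} <->
  {subset xs <= A} /\ exists2 m, m \in A & all (ltn m) xs.
Proof.
case: A => [|m A] /= sA xs_n0; split.
- by case: xs xs_n0 => // x xs _ /(_ x); rewrite inE eqxx => /(_ isT).
- by case=> _ [].
- move=> sub_xs; split=> [x /sub_xs|]; first by rewrite inE orbC => ->.
  exists m; first exact: mem_head.
  by apply/allP=> x /sub_xs; apply: (allP (order_path_min ltn_trans sA)).
case=> sub_xs [m' m'_in lt_m'] x x_in; have := sub_xs x x_in.
rewrite inE => /predU1P[eq_x|//]; have := allP lt_m' x x_in.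
rewrite eq_x /=; move: m'_in; rewrite inE => /predU1P[->|];
  first by rewrite ltnn.
by move/(allP (order_path_min ltn_trans sA)) => /= /ltnW;
  rewrite leqNgt => /negP.
Qed.

Lemma sub_unmax (A xs : seq nat) :
  sorted ltn A -> xs != [::] ->
  {subset xs <= unmax A} <->
  {subset xs <= A} /\ exists2 m, m \in A & all (gtn m) xs.
Proof.
case/lastP: A => [|A m] sA xs_n0; rewrite /unmax ?size_rcons -?cats1 /=.
  split; last by case=> _ [].
  by case: xs xs_n0 => // x xs _ /(_ x); rewrite inE eqxx => /(_ isT).
rewrite take_size_cat //; have lt_m x : x \in A -> x < m.
  move: sA; rewrite -cats1 (sorted_pairwise ltn_trans) pairwise_cat.
  by case/and3P=> /allP lt_A _ _ /lt_A /=; rewrite andbT.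
split=> [sub_xs|[sub_xs [m' m'_in lt_m'] x x_in]].
  split=> [x /sub_xs|]; first by rewrite mem_cat => ->.
  by exists m; [rewrite mem_cat mem_head orbT | apply/allP => x /sub_xs /lt_m].
have := sub_xs x x_in; rewrite mem_cat inE => /orP[//|/eqP eq_x].
have := allP lt_m' x x_in; rewrite eq_x /=.
move: m'_in; rewrite mem_cat inE => /orP[/lt_m|/eqP->]; last by rewrite ltnn.
by move/ltnW; rewrite leqNgt => /negP.
Qed.

(** A legal entry is neither blocked nor repeated to its right, so only the height could exclude it
    from the rows available over [s]. *)
Lemma mem_avail_suffix h B p s x :
  legal h B (p ++ s) -> Some x \in p -> x < h (size s) -> x \in avail h B s.
Proof.
elim: p => //= o p IH /andP[o_ok ps_ok]; rewrite inE => /orP[/eqP eq_o|x_p].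
  move=> lt_x; move: o_ok; rewrite -eq_o !mem_avail => /and3P[-> + _].
  by rewrite mem_cat negb_or => /andP[_ ->].
exact: IH.
Qed.

Lemma has_patternE h B (lt : rel nat) free (Q : seq nat -> Prop) w :
  {homo h : i j / i <= j} -> irreflexive lt ->
  (forall xs, Q xs -> xs != [::]) ->
  (forall A xs, sorted ltn A -> xs != [::] ->
     {subset xs <= free A} <->
     {subset xs <= A} /\ exists2 m, m \in A & all (lt m) xs) ->
  legal h B w -> avail h B w = [::] ->
  has_pattern h lt Q w <-> has_free_window h B free Q w.
Proof.
move=> h_mono lt_irr Q_n0 freeE w_ok w_full; split.
  case=> pre [x0 [mid [xs [s [eq_w Qxs /= /andP[lt_x0 lt_xs] lt_x0xs]]]]].
  exists (pre ++ Some x0 :: mid), xs, s; split=> //; first by rewrite -catA.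
  have in_s x : Some x \in pre ++ Some x0 :: mid ++ map Some xs ->
      x < h (size s) -> x \in avail h B s.
    by apply: mem_avail_suffix; rewrite -catA /= -catA -eq_w.
  apply/freeE; rewrite ?sorted_avail ?(Q_n0 _ Qxs) //; split=> [x x_xs|].
    by apply: in_s (allP lt_xs _ x_xs); rewrite mem_cat inE mem_cat map_f ?orbT.
  by exists x0 => //; apply: in_s lt_x0; rewrite mem_cat mem_head orbT.
case=> pre [xs [s [eq_w Qxs]]].
case/freeE; rewrite ?sorted_avail ?(Q_n0 _ Qxs) // => sub_xs [m m_in lt_m].
(* The word uses every row that is not blocked, so [m] occurs in it. Availability keeps [m] out of
   [s] and irreflexivity keeps it out of the window, hence it stands to the left and can play the
   1. *)
have : Some m \in w.
  move: m_in; rewrite mem_avail => /and3P[Bm _ lt_m_h].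
  apply: contraT => m_w; have : m \in avail h B w; last by rewrite w_full.
  rewrite mem_avail Bm m_w; apply: leq_trans lt_m_h (h_mono _ _ _).
  by rewrite eq_w catA size_cat leq_addl.
rewrite eq_w !mem_cat => /or3P[].
- case/splitPr=> pre1 mid; exists pre1, m, mid, xs, s; split=> //.
    by rewrite -catA.
  apply/allP=> x; rewrite inE => /predU1P[->|/sub_xs].
    by move: m_in; rewrite mem_avail => /and3P[].
  by rewrite mem_avail => /and3P[].
- by rewrite (mem_map Some_inj) => /(allP lt_m); rewrite lt_irr.
by move: m_in; rewrite mem_avail => /and3P[_ /negPf->].
Qed.

Lemma has_patternP h lt Q (w : seq (option nat)) :
  has_pattern h lt Q w <->
  exists c b x0 xs,
    [/\ c < b, b + size xs <= size w, nth None w c = Some x0 &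
        forall a, a < size xs -> nth None w (b + a) = Some (nth 0 xs a)] /\
    [/\ Q xs, all (fun x => x < h (size w - (b + size xs))) (x0 :: xs) &
        all (lt x0) xs].
Proof.
split=> [[pre [x0 [mid [xs [s [-> Qxs lt_h lt_x0]]]]]]|].
  exists (size pre), (size pre + (size mid).+1), x0, xs; split.
    split; rewrite ?nth_cat ?ltnn ?subnn //.
    - by rewrite addnS ltnS leq_addr.
    - by rewrite !size_cat /= !size_cat size_map; lia.
    move=> a lt_a; rewrite -cat_rcons catA nth_cat size_cat size_rcons.
    rewrite addSnnS ltnNge leq_addr /= addKn nth_cat size_map lt_a.
    by rewrite (nth_map 0).
  split=> //; rewrite (_ : _ - _ = size s) //.
  by rewrite !size_cat /= !size_cat size_map; lia.
case=> c [b [x0 [xs [[lt_cb le_b w_c w_b] [Qxs lt_h lt_x0]]]]].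
exists (take c w), x0, (take (b - c.+1) (drop c.+1 w)), xs,
  (drop (b + size xs) w).
split=> //; last by rewrite size_drop.
have eq_xs : take (size xs) (drop b w) = map Some xs.
  have szt : size (take (size xs) (drop b w)) = size xs.
    by rewrite size_takel // size_drop; lia.
  apply: (@eq_from_nth _ None) => [|a]; rewrite szt ?size_map // => lt_a.
  by rewrite nth_take // nth_drop w_b // (nth_map 0).
rewrite -eq_xs addnC -drop_drop cat_take_drop -{2}(subnK lt_cb) -drop_drop.
rewrite cat_take_drop -w_c -drop_nth ?cat_take_drop //; lia.
Qed.

(** * From containment in a filling to occurrences in its word *)

(* Columns are counted from the right. *)
Definition col_height (lam : seq nat) (j : nat) : nat :=
  nth 0 lam (size lam - j.+1).

Lemma nth_young_board lam i j :
  young_board lam -> i <= j -> nth 0 lam j <= nth 0 lam i.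
Proof.
case/andP=> lam_sorted _ le_ij.
have [lt_j|ge_j] := ltnP j (size lam); last by rewrite nth_default.
apply: (sorted_leq_nth (leT := geq)) => //; rewrite ?inE //.
- by move=> y x z le_yx le_zy; apply: leq_trans le_zy le_yx.
- exact: leqnn.
exact: leq_ltn_trans lt_j.
Qed.

Lemma col_height_homo lam :
  young_board lam -> {homo col_height lam : i j / i <= j}.
Proof. by move=> lamP i j le_ij; apply: nth_young_board => //; lia. Qed.

Definition word_seq (lam : seq nat)
    (F : {set 'I_(width lam) * 'I_(height lam)}) : seq (option nat) :=
  [seq omap val (word F c) | c <- enum 'I_(width lam)].

Lemma size_word_seq lam (F : {set 'I_(width lam) * 'I_(height lam)}) :
  size (word_seq F) = size lam.
Proof. by rewrite size_map size_enum_ord. Qed.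

Lemma nth_word_seq lam (F : {set 'I_(width lam) * 'I_(height lam)})
    (c : 'I_(width lam)) :
  nth None (word_seq F) c = omap val (word F c).
Proof. by rewrite (nth_map c) ?size_enum_ord // nth_ord_enum. Qed.

Lemma nth_word_seqP lam (F : {set 'I_(width lam) * 'I_(height lam)}) i x :
  nth None (word_seq F) i = Some x ->
  exists c r, [/\ i = val c, x = val r & word F c = Some r].
Proof.
have [lt_i|ge_i] := ltnP i (width lam); last first.
  by rewrite nth_default ?size_word_seq.
rewrite (nth_word_seq F (Ordinal lt_i)).
case w_i: word => [r|] //= [<-]; by exists (Ordinal lt_i), r.
Qed.

Definition order_iso (k : nat) (s : 'S_k) (xs : seq nat) : Prop :=
  size xs = k /\ forall a b : 'I_k, (nth 0 xs a < nth 0 xs b) = (s a < s b).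

Lemma order_iso_map k (s : 'S_k) (g : nat -> nat) xs :
  {in xs &, {mono g : x y / x < y}} -> order_iso s (map g xs) <->
    order_iso s xs.
Proof.
move=> g_mono; rewrite /order_iso size_map.
by split=> -[szxs iso]; split=> // a b;
  rewrite -iso !(nth_map 0) ?szxs // g_mono //;
  apply: mem_nth; rewrite szxs.
Qed.

Lemma bigmax_ltn (k m : nat) (f : 'I_k -> nat) :
  0 < k -> (\max_(b < k) f b < m) = [forall b, f b < m].
Proof.
move=> k_gt0; apply/idP/forallP => [lt_m b|lt_m].
  exact: leq_ltn_trans (leq_bigmax b) lt_m.
have m_gt0 : 0 < m by exact: leq_trans (lt_m (Ordinal k_gt0)).
by elim/big_ind: _ => // x y lt_x lt_y; rewrite gtn_max lt_x.
Qed.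

(** One statement covers both sums: [d] tells whether the leading entry is below or above the
    others, and [lt] is the order < or > accordingly. *)
Lemma containsP lam (F : {set 'I_(width lam) * 'I_(height lam)}) k
    (sg : vpattern k) (p : vpattern (1 + k)) (d : bool) (lt : rel nat) :
  consecutive sg -> 0 < k -> vadj p = sum_adj (vadj vone) (vadj sg) ->
  (forall a b, (vperm p (rshift 1 a) < vperm p (rshift 1 b)) =
               (vperm sg a < vperm sg b)) ->
  (forall b, (vperm p (lshift k ord0) < vperm p (rshift 1 b)) = d) ->
  (forall x y, lt x y = ((x < y) == d) && ((y < x) == ~~ d)) ->
  contains F p <->
    has_pattern (col_height lam) lt (order_iso (vperm sg)) (word_seq F).
Proof.
move=> sg_cons k_gt0 p_adj p_r p_l ltE; rewrite has_patternP size_word_seq.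
have p_l' b : (vperm p (rshift 1 b) < vperm p (lshift k ord0)) = ~~ d.
  rewrite -(p_l b) -leqNgt [RHS]leq_eqVlt;
    case: eqP => //= /ord_inj/perm_inj/eqP.
  by rewrite eq_rlshift.
have ord_case (P : 'I_(1 + k) -> Prop) :
    P (lshift k ord0) -> (forall b, P (rshift 1 b)) -> forall x, P x.
  by move=> P0 Pr x; rewrite -(splitK x); case: split => a //=; rewrite ord1.
have last_lt : k.-1 < k by rewrite prednK.
pose last_k := Ordinal last_lt.
split.
  case/existsP=> i /existsP[v /and5P[/forallP i_inc /forallP w_i /forallP v_iso
    /forall_inP i_adj /forallP top]].
  pose a0 := Ordinal k_gt0.
  (* Every adjacency of [sg] is imposed, so its columns form an unbroken run. *)
  have i_r (a : 'I_k) : i (rshift 1 a) = i (rshift 1 a0) + a :> nat.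
    case: a => a; elim: a => [|a IH] lt_a; first by rewrite addn0;
      congr (nat_of_ord (i (rshift _ _))); apply: val_inj.
    have lt_a' := ltnW lt_a; rewrite /= addnS -(IH lt_a').
    (* The leading entry moves adjacency [a] of [sg] to [a.+1] in [p]. *)
    pose j : 'I_(1 + k).-1 := Ordinal lt_a.
    have j_adj : j \in vadj p.
      have lt_a1 : a < k.-1 by lia.
      rewrite p_adj inE; apply/orP; right; apply/exists_inP.
      by exists (Ordinal lt_a1); rewrite ?sg_cons ?inE // addn1.
    have /forallP/(_ (rshift 1 (Ordinal lt_a'))) := i_adj _ j_adj.
    move/forallP/(_ (rshift 1 (Ordinal lt_a)))/implyP => /= h.
    by apply/eqP/h; rewrite !eqxx.
  exists (i (lshift k ord0)), (i (rshift 1 a0)), (v (lshift k ord0)),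
    [seq val (v (rshift 1 a)) | a <- enum 'I_k].
  have nth_xs (a : 'I_k) : nth 0 [seq val (v (rshift 1 a)) | a <- enum 'I_k] a =
      v (rshift 1 a).
    by rewrite (nth_map a) ?size_enum_ord // nth_ord_enum.
  have lt_top : i (rshift 1 a0) + k <= size lam.
    by have := ltn_ord (i (rshift 1 last_k)); rewrite i_r /= /width; lia.
  rewrite size_map size_enum_ord; split; split=> //.
  - by have /forallP/(_ (rshift 1 a0))/implyP := i_inc (lshift k ord0); apply.
  - by rewrite nth_word_seq (eqP (w_i _)).
  - move=> a lt_a; have -> : a = Ordinal lt_a by [].
    by rewrite nth_xs -i_r nth_word_seq (eqP (w_i _)).
  - split=> [|a b]; first by rewrite size_map size_enum_ord.
    rewrite !nth_xs -p_r.
    by have /forallP/(_ (rshift 1 b))/eqP := v_iso (rshift 1 a).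
  - have last_top : (rshift 1 last_k).+1 == 1 + k.
      by apply/eqP; rewrite /=; lia.
    have /implyP/(_ last_top)/andP[_] := top (rshift 1 last_k).
    rewrite bigmax_ltn // => /forallP lt_v.
    (* If the run starts in column b, it ends in column b + k - 1 and leaves [size lam] - (b + k)
       columns to its right. The bound on the entries is therefore the height of the last column of
       the run. *)
    have -> : col_height lam (size lam - (i (rshift 1 a0) + k)) =
        nth 0 lam (i (rshift 1 last_k)).
      rewrite /col_height (i_r last_k); congr nth; rewrite /=.
      by move: (nat_of_ord (i (rshift 1 a0))) lt_top => q lt_top; lia.
    rewrite /= lt_v; apply/allP => _ /mapP[a _ ->]; exact: lt_v.
  apply/allP => _ /mapP[a _ ->]; rewrite ltE.
  have /forallP/(_ (rshift 1 a))/eqP-> := v_iso (lshift k ord0).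
  have /forallP/(_ (lshift k ord0))/eqP-> := v_iso (rshift 1 a).
  by rewrite p_l p_l' !eqxx.
case=> c [b [x0 [xs [[lt_cb le_b w_c w_b] [[szxs iso] /= /andP[lt_x0 lt_xs] lt_x]]]]].
rewrite szxs in le_b w_b lt_x0 lt_xs.
have [c0 [r0 [eq_c eq_x0 w_c0]]] := nth_word_seqP w_c.
have lt_b (a : 'I_k) : b + a < width lam by rewrite /width; have := ltn_ord a;
  lia.
have w_r (a : 'I_k) : exists r, word F (Ordinal (lt_b a)) == Some r /\
  val r = nth 0 xs a.
  have [c' [r [eq_c' eq_r w_r]]] := nth_word_seqP (w_b a (ltn_ord a)).
  exists r; split=> //; rewrite -w_r; apply/eqP; congr word; exact: val_inj.
(* The default [r0] is never taken: by [w_r] each column of the window has an entry. *)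
pose val_r (a : 'I_k) : 'I_(height lam) := odflt r0 (word F (Ordinal (lt_b a))).
have val_rP (a : 'I_k) : word F (Ordinal (lt_b a)) = Some (val_r a) /\
  val (val_r a) = nth 0 xs a.
  by rewrite /val_r; have [r [/eqP-> <-]] := w_r a.
pose i : {ffun 'I_(1 + k) -> 'I_(width lam)} := [ffun x =>
  if split x is inr a then Ordinal (lt_b a) else c0].
pose v : {ffun 'I_(1 + k) -> 'I_(height lam)} := [ffun x =>
  if split x is inr a then val_r a else r0].
have splitl : split (lshift k (ord0 : 'I_1)) = inl ord0 by exact: (unsplitK (inl _)).
have splitr a : split (rshift 1 a : 'I_(1 + k)) = inr a by exact: (unsplitK (inr _)).
have i_l : i (lshift k ord0) = c0 by rewrite ffunE splitl.
have v_l : v (lshift k ord0) = r0 by rewrite ffunE splitl.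
have i_r a : i (rshift 1 a) = Ordinal (lt_b a) by rewrite ffunE splitr.
have v_r a : v (rshift 1 a) = val_r a by rewrite ffunE splitr.
have lt_v a : lt r0 (val_r a).
  by rewrite -eq_x0 (val_rP a).2; apply: (allP lt_x); rewrite mem_nth ?szxs.
apply/existsP; exists i; apply/existsP; exists v; apply/and5P; split.
- apply/forallP; elim/ord_case => [|a]; apply/forallP; elim/ord_case => [|a'].
  + by rewrite ltnn.
  + by rewrite i_l i_r -eq_c; apply/implyP=> _ /=; lia.
  + by [].
  by rewrite !i_r /= ltn_add2l; apply/implyP; rewrite ltn_add2l.
- apply/forallP; elim/ord_case => [|a]; first by rewrite i_l v_l w_c0.
  by rewrite i_r v_r (val_rP a).1.
- apply/forallP; elim/ord_case => [|a]; apply/forallP; elim/ord_case => [|a'].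
  + by rewrite !ltnn.
  + by rewrite v_l v_r p_l; have := lt_v a'; rewrite ltE => /andP[].
  + by rewrite v_l v_r p_l'; have := lt_v a; rewrite ltE => /andP[].
  by rewrite !v_r (val_rP a).2 (val_rP a').2 iso p_r.
(* [vone] brings no adjacency, so each one comes from [sg] and joins two columns of the window. *)
- apply/forall_inP => j; rewrite p_adj inE => /orP[/exists_inP[[]] //|].
  case/exists_inP=> b0 _ /eqP eq_j; apply/forallP; elim/ord_case => [|a].
    by apply/forallP=> b'; rewrite eq_j addn1.
  apply/forallP; elim/ord_case => [|a']; first by rewrite andbC.
  rewrite !i_r /= eq_j; apply/implyP=> /andP[/eqP eq_a /eqP eq_a'].
  by apply/eqP; rewrite /=; lia.
apply/forallP; elim/ord_case => [|a]; first by apply/implyP => /= /eqP; lia.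
apply/implyP => /eqP eq_k; rewrite /in_board ltn_ord /= bigmax_ltn //.
have eq_h : col_height lam (size lam - (b + k)) = nth 0 lam (i (rshift 1 a)).
  by rewrite i_r /col_height; congr nth; move: eq_k => /=; lia.
rewrite -eq_h; apply/forallP; elim/ord_case => [|a'];
  first by rewrite v_l -eq_x0.
by rewrite v_r (val_rP a').2; apply: (allP lt_xs); rewrite mem_nth ?szxs.
Qed.

(** * Fillings as legal words that leave no row available *)

Definition blocked (m : nat) (R : {set 'I_m}) : pred nat :=
  fun r => r \in [seq val x | x <- enum R].

Lemma blocked_val m (R : {set 'I_m}) r : blocked R (val r) = (r \in R).
Proof. by rewrite /blocked (mem_map val_inj) mem_enum. Qed.

Definition filling_of (lam : seq nat) (w : seq (option nat)) :
    {set 'I_(width lam) * 'I_(height lam)} :=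
  [set x : 'I_(width lam) * 'I_(height lam) | nth None w x.1 == Some (val x.2)].

Lemma in_filling_of lam w c r :
  ((c, r) \in filling_of lam w) = (nth None w c == Some (val r)).
Proof. by rewrite inE. Qed.

Lemma legalP h B w :
  reflect (forall i x, nth None w i = Some x -> x \in avail h B (drop i.+1 w))
          (legal h B w).
Proof.
elim: w => [|o w IH] /=; first by left=> i x; rewrite nth_nil.
apply: (iffP andP) => [[o_ok /IH w_ok] [|i] x /=|w_ok].
- by move=> eq_o; rewrite drop0; move: o_ok; rewrite eq_o.
- exact: w_ok.
split; last by apply/IH => i x; exact: (w_ok i.+1).
by case: o w_ok => // x /(_ 0 x erefl); rewrite /= drop0.
Qed.

Lemma isSome_shift h B w : map isSome (shift h B w) = map isSome w.
Proof. by elim: w => //= -[x|] w ->. Qed.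

Lemma empty_columnsE lam (F : {set 'I_(width lam) * 'I_(height lam)}) c :
  (c \in empty_columns F) = ~~ nth false (map isSome (word_seq F)) c.
Proof.
rewrite inE (nth_map None) ?size_word_seq // nth_word_seq /word.
case: pickP => [r cr|no_r] /=; apply/forallP; last by move=> r; rewrite no_r.
by move/(_ r); rewrite cr.
Qed.

Lemma col_height_drop lam i (w : seq (option nat)) :
  size w = size lam -> i < size lam ->
  col_height lam (size (drop i.+1 w)) = nth 0 lam i.
Proof. by rewrite /col_height size_drop => -> lt_i; congr nth; lia. Qed.

(** Truncated subtraction makes the height after the whole word that of the leftmost column, so
    [avail] of a complete word ranges over all rows of the board. *)
Lemma col_height_size lam (w : seq (option nat)) : size w = size lam ->
  col_height lam (size w) = height lam.
Proof.
by move=> ->; rewrite /col_height /height -nth0 (eqP (leqnSn _ : _ - _ == 0)).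
Qed.

Lemma wordE lam (F : {set 'I_(width lam) * 'I_(height lam)}) c r :
  is_filling F -> (word F c == Some r) = ((c, r) \in F).
Proof.
case/and3P=> _ /forall_inP col_inj _; rewrite /word.
case: pickP => [r' cr'|->//]; apply/eqP/idP => [[<-]//|cr].
have /forall_inP/(_ _ cr)/implyP/(_ (eqxx _))/eqP[->//] := col_inj _ cr'.
Qed.

(** Legality expresses that cells lie in the board and that no row is used twice; an empty [avail]
    expresses that every row outside [R] is used. *)
Lemma word_seq_filling lam (F : {set 'I_(width lam) * 'I_(height lam)})
    (R : {set 'I_(height lam)}) :
  is_filling F -> empty_rows F = R ->
  [/\ legal (col_height lam) (blocked R) (word_seq F),
      avail (col_height lam) (blocked R) (word_seq F) = [::] &
      filling_of lam (word_seq F) = F].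
Proof.
move=> FP FR; have /and3P[/forall_inP F_in _ /forall_inP row_inj] := FP.
have row_R c r : (c, r) \in F -> r \notin R.
  by move=> cr; rewrite -FR inE; apply/forallPn; exists c; rewrite negbK.
split.
- apply/legalP=> i _ /nth_word_seqP[c [r [-> -> /eqP]]]; rewrite wordE // => cr.
  rewrite mem_avail blocked_val (row_R c) //= col_height_drop ?size_word_seq //.
  have /andP[_ ->] := F_in _ cr; rewrite andbT; apply/negP.
  case/(nthP None)=> j _; rewrite nth_drop.
  case/nth_word_seqP=> c' [r' [eq_c' /val_inj<- /eqP]]; rewrite wordE // => c'r.
  have /forall_inP/(_ _ c'r)/implyP/(_ (eqxx _))/eqP[eq_c] := row_inj _ cr.
  by move: eq_c'; rewrite -eq_c /=; lia.
- apply/eqP; rewrite -[_ == _]negbK -has_filter; apply/negP=> /hasP[r].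
  rewrite mem_iota add0n col_height_size ?size_word_seq // => lt_r /=.
  have -> : r = val (Ordinal lt_r) by [].
  rewrite blocked_val -FR inE negb_forall => /andP[/existsP[c]].
  rewrite negbK -wordE // => /eqP w_c /negP[].
  apply/(nthP None); exists c; first by rewrite size_word_seq.
  by rewrite nth_word_seq w_c.
apply/setP=> -[c r]; rewrite in_filling_of nth_word_seq -wordE //.
by case: word.
Qed.

Lemma filling_of_word lam (R : {set 'I_(height lam)}) w :
  young_board lam -> size w = size lam ->
  legal (col_height lam) (blocked R) w ->
  avail (col_height lam) (blocked R) w = [::] ->
  [/\ is_filling (filling_of lam w), empty_rows (filling_of lam w) = R &
      word_seq (filling_of lam w) = w].
Proof.
move=> lamP szw /legalP w_ok w_full.
have ltw i x : nth None w i = Some x -> i < size lam.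
  by move=> w_i; rewrite -szw ltnNge; apply/negP => ?;
    rewrite nth_default in w_i.
split.
- apply/and3P; split; apply/forall_inP=> -[c r];
  rewrite in_filling_of => /eqP w_c.
  + have := w_ok _ _ w_c; rewrite mem_avail col_height_drop ?(ltw _ _ w_c) //.
    by case/and3P=> _ _ lt_r; rewrite /in_board ltn_ord.
  + apply/forall_inP=> -[c' r']; rewrite in_filling_of => /eqP w_c'.
    apply/implyP=> /= /eqP eq_c; move: w_c'; rewrite -eq_c w_c => -[/val_inj->].
    by rewrite eqxx.
  apply/forall_inP=> -[c' r']; rewrite in_filling_of => /eqP w_c'.
  apply/implyP=> /= /eqP eq_r; rewrite -eq_r in w_c' *;
    rewrite xpair_eqE eqxx andbT.
  (* A row used twice contradicts legality at the left one of the two columns, whose entry must not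
     recur to its right. *)
  have no_lt i j x : nth None w i = Some x -> nth None w j = Some x -> i < j -> False.
    move=> w_i w_j lt_ij; have := w_ok _ _ w_i;
      rewrite mem_avail => /and3P[_ /negP[]].
    apply/(nthP None); exists (j - i.+1); last by rewrite nth_drop subnKC.
    by rewrite size_drop ltn_sub2r ?szw ?(ltw _ _ w_j) //;
      apply: leq_ltn_trans lt_ij (ltw _ _ w_j).
  rewrite -(inj_eq val_inj) /=; case: ltngtP =>
    // [/(no_lt _ _ _ w_c w_c')|/(no_lt _ _ _ w_c' w_c)] //.
- apply/setP=> r; rewrite inE -blocked_val; apply/forallP/idP => [no_c|Br c].
    apply: contraT => Br; have : val r \in avail (col_height lam) (blocked R) w.
      rewrite mem_avail Br col_height_size // ltn_ord andbT.
      apply/negP=> /(nthP None)[c]; rewrite szw => lt_c w_c.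
      by have := no_c (Ordinal lt_c); rewrite in_filling_of w_c eqxx.
    by rewrite w_full.
  rewrite in_filling_of; apply/eqP=> /w_ok; by rewrite mem_avail Br.
apply: (@eq_from_nth _ None) => [|i]; rewrite size_word_seq // => lt_i.
rewrite (nth_word_seq _ (Ordinal lt_i)) /word; case: pickP => [r|no_r].
  by rewrite in_filling_of => /eqP->.
case w_i: nth => [x|] //.
have lt_x : x < height lam.
  have := w_ok _ _ w_i; rewrite mem_avail col_height_drop // =>
    /and3P[_ _ lt_x].
  by apply: leq_trans lt_x _; rewrite /height -nth0; apply: nth_young_board.
by have := no_r (Ordinal lt_x); rewrite in_filling_of /= w_i eqxx.
Qed.

(** * Comparing the numbers of avoiders *)

Lemma card_avoid_eq (T : finType) (D P Q : {set T}) (f : T -> T) :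
  {in D &, injective f} -> (forall x, x \in D -> f x \in D) ->
  (forall x, x \in D -> (f x \in Q) = (x \in P)) ->
  #|D :&: P| = #|D :&: Q|.
Proof.
(* An injection of a finite set into itself is onto, so [f] permutes [D]. *)
move=> f_inj f_D f_PQ; have fD : f @: D = D.
  apply/eqP; rewrite eqEcard card_in_imset // leqnn andbT.
  by apply/subsetP=> _ /imsetP[x xD ->]; apply: f_D.
rewrite -(card_in_imset (f := f)) => [|x y /setIP[xD _] /setIP[yD _]];
  last exact: f_inj.
congr #|pred_of_set _|; apply/setP=> y; rewrite inE; apply/imsetP/andP.
  by case=> x /setIP[xD xP] ->; rewrite f_D // f_PQ.
case; rewrite -{1}fD => /imsetP[x xD ->]; rewrite f_PQ // => xP.
by exists x; rewrite // inE xD.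
Qed.

(** Settles the empty [sigma] separately, since the argument on windows needs a nonempty window. *)
Lemma dsum_eq_skewsum0 (sigma : vpattern 0) : dsum vone sigma = skewsum vone sigma.
Proof.
congr VPattern; apply/permP => x; apply: val_inj.
have val0 (y : 'I_(1 + 0)) : val y = 0 by case: y => -[].
by rewrite !val0.
Qed.

Theorem theorem3p11 (k : nat) (sigma : vpattern k) (hsigma : consecutive sigma) :
  filling_shape_Wilf_equivalent (dsum vone sigma) (skewsum vone sigma).
Proof.
case: (posnP k) => [k0|k_gt0].
  by move: sigma hsigma; rewrite k0 => sigma _ lam _ C R;
    rewrite dsum_eq_skewsum0.
move=> lam lamP C R; pose h := col_height lam; pose B := blocked R.
have h_mono : {homo h : i j / i <= j} := col_height_homo lamP.
pose D := [set F : {set 'I_(width lam) * 'I_(height lam)} |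
  [&& is_filling F, empty_columns F == C & empty_rows F == R]].
have avoidersE l (p : vpattern l) :
    avoiders C R p = D :&: [set F | ~~ contains F p].
  by apply/setP=> F; rewrite !inE -!andbA.
have split_l : split (lshift k (ord0 : 'I_1)) = inl ord0 by exact: (unsplitK (inl _)).
have split_r a : split (rshift 1 a : 'I_(1 + k)) = inr a by exact: (unsplitK (inr _)).
have dsumP (F : {set 'I_(width lam) * 'I_(height lam)}) : contains F (dsum vone sigma) <->
    has_pattern h ltn (order_iso (vperm sigma)) (word_seq F).
  apply: (@containsP lam F k sigma _ true) => //.
  - by move=> a b; rewrite !permE /dsum_fun !split_r /= ltn_add2l.
  - by move=> b; rewrite !permE /dsum_fun split_l split_r /= perm1.
  by move=> x y /=; case: ltngtP.
have skewsumP (F : {set 'I_(width lam) * 'I_(height lam)}) : contains F (skewsum vone sigma) <->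
    has_pattern h gtn (order_iso (vperm sigma)) (word_seq F).
  apply: (@containsP lam F k sigma _ false) => //.
  - by move=> a b; rewrite !permE /skewsum_fun !split_r.
  - move=> b; rewrite !permE /skewsum_fun split_l split_r /= perm1.
    by apply/negbTE; rewrite -leqNgt addn0 ltnW.
  by move=> x y /=; case: ltngtP.
have iso_n0 xs : order_iso (vperm sigma) xs -> xs != [::].
  by case=> szxs _; apply: contraTneq k_gt0 => xs0; rewrite -szxs xs0.
rewrite !avoidersE.
pose f (F : {set 'I_(width lam) * 'I_(height lam)}) :=
  filling_of lam (shift h B (word_seq F)).
have fP F : F \in D -> [/\ is_filling (f F) /\ empty_rows (f F) = R,
    word_seq (f F) = shift h B (word_seq F), legal h B (word_seq F),
    avail h B (word_seq F) = [::] &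
    avail h B (word_seq (f F)) = [::] /\ filling_of lam (word_seq F) = F].
  rewrite inE => /and3P[FP _ /eqP FR]; have [w_ok w_full FE] :=
    word_seq_filling FP FR.
  have [w'_ok szA] := legal_shift h_mono w_ok.
  have w'_full : avail h B (shift h B (word_seq F)) = [::].
    by apply: size0nil; rewrite szA w_full.
  have [|fFP fR fE] := filling_of_word lamP _ w'_ok w'_full.
    by rewrite size_shift size_word_seq.
  by rewrite fE.
apply: (card_avoid_eq (f := f)) => [F1 F2 D1 D2 eq_f|F DF|F DF].
- have [_ w1 ok1 _ [_ <-]] := fP _ D1; have [_ w2 ok2 _ [_ <-]] := fP _ D2.
  congr filling_of; apply: (shift_inj h_mono ok1 ok2); by rewrite -w1 -w2 eq_f.
(* The empty rows are kept through [B], and the empty columns because the shift leaves every empty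
   entry empty. *)
- have [[fF_ok fR] w' _ _ _] := fP _ DF; rewrite inE fF_ok fR eqxx andbT /=.
  move: DF; rewrite inE => /and3P[_ /eqP <- _]; apply/eqP/setP=> c.
  by rewrite !empty_columnsE w' isSome_shift.
have [_ w' w_ok w_full [w'_full _]] := fP _ DF.
have w'_ok : legal h B (word_seq (f F)).
  by rewrite w'; have [] := legal_shift h_mono w_ok.
have gtn_irr : irreflexive gtn by move=> x; exact: ltnn.
have dsum_free := has_patternE h_mono ltnn iso_n0 sub_behead w_ok w_full.
have skewsum_free := has_patternE h_mono gtn_irr iso_n0 sub_unmax w'_ok w'_full.
(* This links the two descriptions: windows of [F] missing the minimum correspond to windows of
   [f F] missing the maximum. *)
have free_shift :=
  free_window_shift h_mono w_ok (@order_iso_map _ (vperm sigma)).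
rewrite !inE; congr negb; rewrite w' in skewsum_free.
apply/idP/idP => [/skewsumP|/dsumP] has_p; [apply/dsumP|apply/skewsumP].
  by apply/dsum_free/free_shift/skewsum_free; rewrite -w'.
by rewrite w'; apply/skewsum_free/free_shift/dsum_free.
Qed.
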